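(* An arithmetic divisor on $\overline{\operatorname{Spec}\mathbf{Z}}$ is a pair $(L,\|\cdot\|)$ with $L$ a torsion-free abelian group of rank $1$ and $\|\cdot\|$ a semi-norm on $L_\mathbf{R}=L\otimes_\mathbf{Z}\mathbf{R}$ of the form $\|v\|=\lambda|\phi(v)|$ for some isomorphism $\phi:L_\mathbf{R}\to\mathbf{R}$ and some $\lambda\ge0$. Two such, $(L_1,\|\cdot\|_1)$ and $(L_2,\|\cdot\|_2)$, are isomorphic if there is a group isomorphism $\psi:L_1\to L_2$ with $\|\psi(x)\|_2=\|x\|_1$ for all $x$ (extending $\psi$ to $L_{1,\mathbf{R}}$). The product is $(L_1,\|\cdot\|_1)\cdot(L_2,\|\cdot\|_2)=(L_1\otimes_\mathbf{Z}L_2,\|\cdot\|)$ with $\|v_1\otimes v_2\|=\|v_1\|_1\|v_2\|_2$. Let $\operatorname{Pic}(\overline{\operatorname{Spec}\mathbf{Z}})$ be the monoid of isomorphism classes with this product. Let $\mathbb{A}=\mathbb{A}_f\times\mathbf{R}$ be the adeles of $\mathbf{Q}$, $\widehat{\mathbf{Z}}\subset\mathbb{A}_f$ the profinite integers, and $X_\mathbf{Q}=\mathbf{Q}^\times\backslash\mathbb{A}/\widehat{\mathbf{Z}}^\times$ with the monoid structure induced by multiplication of adeles. For $a=(a_f,a_\infty)\in\mathbb{A}$ let $\Lambda(a)=(L_a,\|\cdot\|_a)$, where $L_a=\{q\in\mathbf{Q}\mid a_fq\in\widehat{\mathbf{Z}}\}$ and $\|v\|_a=|a_\infty|\,|v|$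 via the canonical identification $L_a\otimes\mathbf{R}\cong\mathbf{Q}\otimes\mathbf{R}\cong\mathbf{R}$. Then $\Lambda$ induces a canonical monoid isomorphism $X_\mathbf{Q}\cong\operatorname{Pic}(\overline{\operatorname{Spec}\mathbf{Z}})$. *)

(* Defs.v *)
From HB Require Import structures.
From mathcomp Require Import all_boot all_order all_algebra.
From mathcomp Require Import reals.
Set Implicit Arguments. Unset Strict Implicit. Unset Printing Implicit Defensive.
Import Order.TTheory GRing.Theory Num.Theory.
Local Open Scope ring_scope.

(* Profinite integers  Zhat = lim_n Z/nZ, represented by compatible        *)
(* sequences x : nat -> int (x n meaningful modulo n, for n >= 1;          *)
(* the value x 0 is irrelevant).  Equality is congruence at every level.   *)
Definition is_zhat (x : nat -> int) : Prop :=
  forall n m : nat, (0 < n)%N -> (0 < m)%N -> (n %| m)%N ->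
    (x m = x n %[mod n%:Z])%Z.

Definition zhat_eq (x y : nat -> int) : Prop :=
  forall n : nat, (0 < n)%N -> (x n = y n %[mod n%:Z])%Z.

Definition zhat_mul (x y : nat -> int) : nat -> int := fun n => x n * y n.
Definition zhat_const (c : int) : nat -> int := fun _ => c.
Definition zhat_scale (c : int) (x : nat -> int) : nat -> int := fun n => c * x n.

Definition is_zhat_unit (u : nat -> int) : Prop :=
  is_zhat u /\ exists v, is_zhat v /\ zhat_eq (zhat_mul u v) (zhat_const 1).

(* Adeles A = A_f x R, with A_f = Zhat (x)_Z Q: a finite adele is z / d    *)
(* with z in Zhat, d >= 1.                                                 *)
Record adele (R : realType) := Adele {
  af_num : nat -> int;
  af_den : nat;
  a_inf  : R
}.

Definition is_adele (R : realType) (a : adele R) : Prop :=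
  is_zhat (af_num a) /\ (0 < af_den a)%N.

Definition adele_eq (R : realType) (a b : adele R) : Prop :=
  zhat_eq (zhat_scale (af_den b)%:Z (af_num a))
          (zhat_scale (af_den a)%:Z (af_num b))
  /\ a_inf a = a_inf b.

Definition adele_mul (R : realType) (a b : adele R) : adele R :=
  Adele (zhat_mul (af_num a) (af_num b)) (af_den a * af_den b)%N
        (a_inf a * a_inf b).

Definition adele_act (R : realType) (q : rat) (u : nat -> int) (a : adele R) : adele R :=
  Adele (zhat_scale (numq q) (zhat_mul (af_num a) u))
        (absz (denq q) * af_den a)%N
        (ratr q * a_inf a).

Definition XQ_rel (R : realType) (a b : adele R) : Prop :=
  exists q : rat, q != 0 /\
  exists u, is_zhat_unit u /\ adele_eq b (adele_act q u a).

(* Arithmetic divisors.  The group L is given as a subgroup S of an       *)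
(* abelian group V; the semi-norm on L_R = L (x) R is recorded by its     *)
(* restriction N to L (which determines it).                *)
Definition subgroup (V : zmodType) (S : V -> Prop) : Prop :=
  S 0 /\ forall x y, S x -> S y -> S (x - y).

Definition torsion_free (V : zmodType) (S : V -> Prop) : Prop :=
  forall x, S x -> forall n : nat, (0 < n)%N -> x *+ n = 0 -> x = 0.

Definition rank_one (V : zmodType) (S : V -> Prop) : Prop :=
  (exists x, S x /\ x <> 0) /\
  forall x y, S x -> S y ->
    exists m n : int, (m <> 0 \/ n <> 0) /\ x *~ m = y *~ n.

Definition additive_on (V W : zmodType) (S : V -> Prop) (f : V -> W) : Prop :=
  forall x y, S x -> S y -> f (x + y) = f x + f y.

(* ||v|| = lambda |phi v| with phi : L_R ~ R an isomorphism, lambda >= 0;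
   restricted to L, phi is an injective group homomorphism L -> R *)
Definition admissible_norm (R : realType) (V : zmodType) (S : V -> Prop)
    (N : V -> R) : Prop :=
  exists lam : R, 0 <= lam /\
  exists f : V -> R, additive_on S f /\ (forall x, S x -> f x = 0 -> x = 0) /\
    forall x, S x -> N x = lam * `|f x|.

Definition arith_divisor (R : realType) (V : zmodType) (S : V -> Prop)
    (N : V -> R) : Prop :=
  [/\ subgroup S, torsion_free S, rank_one S & admissible_norm S N].

Definition ad_iso (R : realType) (V1 V2 : zmodType)
    (S1 : V1 -> Prop) (N1 : V1 -> R) (S2 : V2 -> Prop) (N2 : V2 -> R) : Prop :=
  exists psi : V1 -> V2,
    [/\ additive_on S1 psi,
        (forall x, S1 x -> S2 (psi x)),
        (forall x y, S1 x -> S1 y -> psi x = psi y -> x = y),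
        (forall y, S2 y -> exists2 x, S1 x & psi x = y) &
        (forall x, S1 x -> N2 (psi x) = N1 x)].

Definition biadditive_on (V1 V2 W : zmodType) (S1 : V1 -> Prop) (S2 : V2 -> Prop)
    (g : V1 -> V2 -> W) : Prop :=
  (forall x x' y, S1 x -> S1 x' -> S2 y -> g (x + x') y = g x y + g x' y) /\
  (forall x y y', S1 x -> S2 y -> S2 y' -> g x (y + y') = g x y + g x y').

Definition is_tensor (V1 V2 V : zmodType) (S1 : V1 -> Prop) (S2 : V2 -> Prop)
    (S : V -> Prop) (beta : V1 -> V2 -> V) : Prop :=
  [/\ (forall x y, S1 x -> S2 y -> S (beta x y)),
      biadditive_on S1 S2 beta &
      forall (M : zmodType) (g : V1 -> V2 -> M), biadditive_on S1 S2 g ->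
        (exists h : V -> M, additive_on S h /\
            forall x y, S1 x -> S2 y -> h (beta x y) = g x y) /\
        (forall h1 h2 : V -> M, additive_on S h1 -> additive_on S h2 ->
            (forall x y, S1 x -> S2 y -> h1 (beta x y) = h2 (beta x y)) ->
            forall z, S z -> h1 z = h2 z)].

Definition is_product (R : realType) (V1 V2 V : zmodType)
    (S1 : V1 -> Prop) (N1 : V1 -> R) (S2 : V2 -> Prop) (N2 : V2 -> R)
    (S : V -> Prop) (N : V -> R) : Prop :=
  exists beta : V1 -> V2 -> V, is_tensor S1 S2 S beta /\
    forall x y, S1 x -> S2 y -> N (beta x y) = N1 x * N2 y.

(* q in L_a  iff  a_f q = z numq / (d denq) lies in Zhat *)
Definition La (R : realType) (a : adele R) (q : rat) : Prop :=
  exists w, is_zhat w /\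
    zhat_eq (zhat_scale (af_den a * absz (denq q))%:Z w)
            (zhat_scale (numq q) (af_num a)).

Definition Na (R : realType) (a : adele R) (q : rat) : R :=
  `|a_inf a| * `|ratr q|.

(* Main.v *)
Require Import Defs.
From HB Require Import structures.
From mathcomp Require Import all_boot all_order all_algebra.
From mathcomp Require Import reals.
From mathcomp Require Import boolp classical_sets filter.
From mathcomp Require Import ring zify.
Import Order.TTheory GRing.Theory Num.Theory.
Local Open Scope ring_scope.

(* Write the finite part of an adele as z / d with z a profinite integer. Then
   L_a is the group of the rationals m / e such that d e divides m z, so it
   only depends on d and on the set of the integers dividing z. The theorem
   rests on three facts: two profinite integers with the same integer divisors
   differ by a unit; if e divides z z' then e = e1 e2 with e1 | z and e2 | z';
   every set of positive integers containing 1 and closed under divisors and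
   lcm is the set of the divisors of some z. The first and the last follow from
   solutions modulo each n by compactness of the profinite integers.
   Finally, every isomorphism L_a -> L_b is multiplication by a rational, and
   the elements of L_a (x) L_b are pure tensors because finitely generated
   subgroups of Q are cyclic. *)

(** * Profinite integers *)

Lemma eqz_modP (d x y : int) : (x = y %[mod d])%Z <-> (d %| x - y)%Z.
Proof. by rewrite -eqz_mod_dvd; split=> [/eqP|/eqP]. Qed.

Lemma zhat_levelP (x : nat -> int) (n m : nat) :
  is_zhat x -> (0 < n)%N -> (0 < m)%N -> (n %| m)%N ->
  (n%:Z %| x m - x n)%Z.
Proof. by move=> zx n0 m0 nm; apply/eqz_modP/zx. Qed.

(** Divisibility by n can be tested at any multiple of n, so conditions at different levels are
    compared by moving them to a common one. *)
Lemma zhat_dvd_level (x : nat -> int) (k : int) (n m : nat) :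
  is_zhat x -> (0 < n)%N -> (0 < m)%N -> (n %| m)%N ->
  (n%:Z %| k * x m)%Z = (n%:Z %| k * x n)%Z.
Proof.
move=> zx n0 m0 nm; have /dvdzP[q e] := zhat_levelP _ _ _ zx n0 m0 nm.
have -> : k * x m = k * x n + k * q * n%:Z by rewrite -mulrA -e; ring.
by rewrite rpredDr // dvdz_mull.
Qed.

Lemma is_zhat_mul (x y : nat -> int) :
  is_zhat x -> is_zhat y -> is_zhat (zhat_mul x y).
Proof.
move=> zx zy n m n0 m0 nm; apply/eqz_modP; rewrite /zhat_mul.
have -> : x m * y m - x n * y n = y m * (x m - x n) + x n * (y m - y n) by ring.
by rewrite rpredD // dvdz_mull // zhat_levelP.
Qed.

Lemma is_zhat_const (c : int) : is_zhat (zhat_const c).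
Proof. by []. Qed.

Lemma is_zhat_scale (c : int) (x : nat -> int) : is_zhat x -> is_zhat (zhat_scale c x).
Proof. exact/is_zhat_mul/is_zhat_const. Qed.

(** One residue decides. Knowing the quotient modulo n requires [z] modulo c n, hence the values
    [z (c * n) %/ c]. *)
Lemma zhat_dvdP (c : nat) (z : nat -> int) : (0 < c)%N -> is_zhat z ->
  (exists w, is_zhat w /\ zhat_eq (zhat_scale c%:Z w) z) <-> (c%:Z %| z c)%Z.
Proof.
move=> c0 zz; split=> [[w [_ /(_ c c0)/eqz_modP]]|cz].
  by rewrite /zhat_scale rpredBl // dvdz_mulr.
have c0z : c%:Z != 0 by rewrite eqz_nat -lt0n.
have cn n : (0 < n)%N -> (c%:Z %| z (c * n)%N)%Z.
  move=> n0; have := zhat_levelP _ c (c * n)%N zz c0.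
  by rewrite muln_gt0 c0 n0 dvdn_mulr // => /(_ isT isT); rewrite rpredBr.
have wE n : (0 < n)%N -> c%:Z * (z (c * n)%N %/ c)%Z = z (c * n)%N.
  by move=> n0; rewrite mulrC divzK // cn.
exists (fun n => (z (c * n)%N %/ c)%Z); split.
  move=> n m n0 m0 nm; apply/eqz_modP; rewrite -(dvdz_mul2l c0z) mulrBr !wE //.
  by rewrite -PoszM zhat_levelP ?muln_gt0 ?c0 // dvdn_pmul2l.
move=> n n0; apply/eqz_modP; rewrite /zhat_scale wE // zhat_levelP ?muln_gt0 ?c0 //.
exact: dvdn_mull.
Qed.

(** Compactness: an ultrafilter containing all tails selects a residue of [a] modulo each n. Members
    of the ultrafilter meet each other and every tail, whence compatibility and arbitrarily large
    indices. *)
Lemma zhat_cluster (a : nat -> int) : exists x : nat -> int, is_zhat x /\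
  forall n K : nat, (0 < n)%N -> exists2 m, (K <= m)%N & (a m = x n %[mod n%:Z])%Z.
Proof.
have [U [UU sU]] := ultraFilterLemma eventually_filter.
have res n : exists r : int, (0 < n)%N -> U [set m | (a m = r %[mod n%:Z])%Z]%classic.
  apply/not_existsP => H.
  have n0 : (0 < n)%N by apply/negP => n0; apply: (H 0).
  (* If no class modulo n were selected, the intersection of their complements would be in [U],
     hence nonempty; but every [a m] has a residue. *)
  have Ui k : U [set m | forall i : nat, (i < k)%N -> (a m <> i %[mod n%:Z])%Z]%classic.
    elim: k => [|k IH]; first exact: filterS filterT.
    have [Uk|Uk] := in_ultra_setVsetC [set m | (a m = k%:Z %[mod n%:Z])%Z]%classic UU.
      by case: (H k%:Z).
    apply: filterS2 IH Uk => m /= Hm hk i; rewrite ltnS leq_eqVlt => /orP[/eqP->//|].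
    exact: Hm.
  have := filter_ex (Ui n); case=> m /(_ `|(a m %% n)%Z|%N).
  have n0z : n%:Z != 0 by rewrite eqz_nat -lt0n.
  rewrite -ltz_nat gez0_abs ?modz_ge0 // ltz_pmod ?ltz_nat //.
  by move=> /(_ isT); apply; rewrite modz_mod.
have [x xP] := choice res; exists x; split.
  move=> n m n0 m0 nm; have [k [/= kn km]] := filter_ex (filterI (xP n n0) (xP m m0)).
  apply/eqz_modP; move/eqz_modP: kn => kn; move/eqz_modP: km => km.
  have -> : x m - x n = (a k - x n) - (a k - x m) by ring.
  by rewrite rpredB //; apply: dvdz_trans km; rewrite dvdzE.
move=> n K n0; have UK : U [set m | (K <= m)%N]%classic by apply: sU; exists K.
by have [m [/= ]] := filter_ex (filterI (xP n n0) UK); exists m.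
Qed.

(** * Units modulo n and profinite units *)

(** Let w > 0 represent u, and let k be the part of n prime to w. A prime divisor of n divides
    exactly one of w and k n1, so w + k n1 is prime to n. *)
Lemma unit_lift (n n1 : nat) (u : int) : (0 < n)%N -> (n1 %| n)%N ->
  coprimez u n1%:Z ->
  exists v : int, coprimez v n%:Z /\ (v = u %[mod n1%:Z])%Z.
Proof.
move=> n0 n1n cu.
have n10 : (0 < n1)%N by apply: dvdn_gt0 n1n.
have [w [w0 wu]] : exists w : nat, (0 < w)%N /\ (w%:Z = u %[mod n1%:Z])%Z.
  (* Adding [n1] makes w positive, so that [\pi(w)] is the set of all primes dividing w. *)
  exists (`|(u %% n1)%Z| + n1)%N; split; first by rewrite addn_gt0 n10 orbT.
  by rewrite PoszD gez0_abs ?modz_ge0 ?eqz_nat -?lt0n // modzDr modz_mod.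
have cw : coprime w n1.
  move/eqz_modP: wu => /dvdzP[q wu].
  have : coprimez w%:Z n1%:Z.
    have -> : w%:Z = q * n1%:Z + u by rewrite -wu; ring.
    by rewrite coprimez_sym /coprimez gcdzMDl -/(coprimez _ _) coprimez_sym.
  by [].
pose k := (n`_(\pi(w)^'))%N.
exists (w + k * n1)%N%:Z; split; last first.
  by rewrite -wu PoszD PoszM addrC modzMDl.
change (coprime (w + k * n1) n); apply/contraT => nc.
have /pdiv_prime pp : (1 < gcdn (w + k * n1) n)%N.
  by rewrite ltn_neqAle eq_sym nc gcdn_gt0 n0 orbT.
set p := pdiv _ in pp.
have /andP[pv pn] : (p %| w + k * n1)%N && (p %| n)%N by rewrite -dvdn_gcd pdiv_dvd.
have pk : (p %| k)%N = ~~ (p %| w)%N.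
  have k0 : (0 < k)%N by rewrite part_gt0.
  have := mem_primes p k; rewrite pp k0 /= => <-; rewrite primes_part mem_filter.
  by rewrite !inE !mem_primes pp n0 w0 pn /= andbT.
have [pw|pw] := boolP (p %| w)%N; last first.
  by move: pv; rewrite dvdn_addl ?(negPf pw) //; apply: dvdn_mulr; rewrite pk.
move: pv; rewrite dvdn_addr // Euclid_dvdM // pk pw /= => pn1.
have : (p %| gcdn w n1)%N by rewrite dvdn_gcd pw.
by rewrite (eqP cw) dvdn1 => /eqP p1; rewrite p1 in pp.
Qed.

(** Divided by the common gcd g, both x and y become units modulo n / g; their ratio is a unit there
    and lifts to a unit modulo n. *)
Lemma eq_gcdz_unit (x y : int) (n : nat) : (0 < n)%N ->
  gcdz x n%:Z = gcdz y n%:Z ->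
  exists u : int, coprimez u n%:Z /\ (y = u * x %[mod n%:Z])%Z.
Proof.
move=> n0 gxy; set g := gcdn `|x| n.
have g0 : (0 < g)%N by rewrite gcdn_gt0 n0 orbT.
have g0z : g%:Z != 0 by rewrite eqz_nat -lt0n.
have gE : gcdz x n%:Z = g%:Z by [].
have /dvdzP[x1 xE] : (g%:Z %| x)%Z by rewrite -gE dvdz_gcdl.
have /dvdzP[y1 yE] : (g%:Z %| y)%Z by rewrite -gE gxy dvdz_gcdl.
have /dvdnP[n1 nE] : (g %| n)%N by exact: dvdn_gcdr.
have nEz : n%:Z = n1%:Z * g%:Z by rewrite nE PoszM.
have cop z z1 : z = z1 * g%:Z -> gcdz z n%:Z = g%:Z -> coprimez z1 n1%:Z.
  move=> zE Eg; have := mulz_gcdl z1 n1%:Z g%:Z.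
  by rewrite -zE -nEz Eg -[RHS]mul1r => /(mulIf g0z)/eqP.
have cx := cop x x1 xE erefl.
have cy := cop y y1 yE (etrans (esym gxy) gE).
have /coprimezP[[s t] /= st] := cx.
have cs : coprimez s n1%:Z by apply/coprimezP; exists (x1, t); rewrite /= mulrC.
have csy : coprimez (y1 * s) n1%:Z by rewrite coprimezMl cy.
have n1n : (n1 %| n)%N by rewrite nE dvdn_mulr.
have [u [cu /eqz_modP/dvdzP[q uE]]] := unit_lift n n1 (y1 * s) n0 n1n csy.
exists u; split=> //; apply/eqz_modP/dvdzP; exists (y1 * t - q * x1).
have -> : u = q * n1%:Z + y1 * s by rewrite -uE; ring.
rewrite xE yE nEz; have -> : y1 * g = y1 * g * (s * x1 + t * n1%:Z) by rewrite st mulr1.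
ring.
Qed.

(** The gcd of [x n] and n is itself a positive integer dividing x, so the hypothesis applies to
    it. *)
Lemma zhat_gcd_dvd (x y : nat -> int) (n : nat) : is_zhat x -> is_zhat y -> (0 < n)%N ->
  (forall k : nat, (0 < k)%N -> (k%:Z %| x k)%Z -> (k%:Z %| y k)%Z) ->
  (gcdz (x n) n%:Z %| gcdz (y n) n%:Z)%Z.
Proof.
move=> zx zy n0 xy; rewrite dvdz_gcd dvdz_gcdr andbT.
pose g := gcdn `|x n| n; have gE : gcdz (x n) n%:Z = g%:Z by [].
rewrite gE.
have g0 : (0 < g)%N by rewrite gcdn_gt0 n0 orbT.
have gn : (g %| n)%N by exact: dvdn_gcdr.
have := zhat_dvd_level _ 1 _ _ zy g0 n0 gn; rewrite !mul1r => ->.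
apply: xy => //; have := zhat_dvd_level _ 1 _ _ zx g0 n0 gn; rewrite !mul1r => <-.
by rewrite -gE dvdz_gcdl.
Qed.

(** Inverses modulo n are unique, so those chosen level by level are compatible. *)
Lemma zhat_unitP (u : nat -> int) : is_zhat u ->
  (forall n : nat, (0 < n)%N -> coprimez (u n) n%:Z) -> is_zhat_unit u.
Proof.
move=> zu cu; split=> //.
have inv n : exists v, (0 < n)%N -> (n%:Z %| u n * v - 1)%Z.
  have [->|n0] := posnP n; first by exists 0.
  have /coprimezP[[s t] /= st] := cu n n0; exists s => _.
  by apply/dvdzP; exists (- t); rewrite -st; ring.
have [v vP] := choice inv; exists v; split; last by move=> n n0; apply/eqz_modP/vP.
move=> n m n0 m0 nm; apply/eqz_modP.
have cun : coprimez n%:Z (u n) by rewrite coprimez_sym cu.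
rewrite -(Gauss_dvdzr _ cun).
have vm : (n%:Z %| u m * v m - 1)%Z by apply: dvdz_trans (vP m m0); rewrite dvdzE.
have -> : u n * (v m - v n) =
  (u m * v m - 1) - (u n * v n - 1) - v m * (u m - u n) by ring.
apply: rpredB; first by apply: rpredB => //; exact: vP.
by rewrite dvdz_mull // zhat_levelP.
Qed.

Lemma zhat_unit_coprime (u : nat -> int) (n : nat) : is_zhat_unit u -> (0 < n)%N ->
  coprimez (u n) n%:Z.
Proof.
move=> [_ [v [_ uv]]] n0; have /eqz_modP/dvdzP[q e] := uv n n0.
apply/coprimezP; exists (v n, - q) => /=.
by move: e; rewrite /zhat_mul /zhat_const => e; rewrite mulNr -e; ring.
Qed.

(* Modulo n! a unit relating x and y exists because both have the same gcd
   with n!; these units need not be compatible, and a cluster point of them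
   is a unit that works at every level. *)
Lemma same_divisors_unit (x y : nat -> int) : is_zhat x -> is_zhat y ->
  (forall k : nat, (0 < k)%N -> (k%:Z %| x k)%Z = (k%:Z %| y k)%Z) ->
  exists u, is_zhat_unit u /\ zhat_eq y (zhat_mul u x).
Proof.
move=> zx zy xy.
have lev (n : nat) : exists u : int, coprimez u n`!%:Z /\
    (y n`! = u * x n`! %[mod n`!%:Z])%Z.
  apply: eq_gcdz_unit; rewrite ?fact_gt0 //; congr Posz.
  apply/eqP; rewrite eqn_dvd.
  by apply/andP; split; apply: zhat_gcd_dvd; rewrite ?fact_gt0 // => k k0; rewrite xy.
have [a aP] := choice lev; have [u [zu ua]] := zhat_cluster a.
(* Every positive n divides m! once m >= n, so relations modulo factorials descend to all levels. *)
have dfact n m : (0 < n)%N -> (n <= m)%N -> (n %| m`!)%N.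
  by move=> n0 nm; apply: dvdn_fact; rewrite n0.
exists u; split.
  apply: zhat_unitP => // n n0; have [m nm /eqz_modP/dvdzP[q e]] := ua n n n0.
  have [ca _] := aP m; have := coprimez_dvdr (dfact n m n0 nm) ca.
  have -> : a m = q * n%:Z + u n by rewrite -e; ring.
  by rewrite coprimez_sym /coprimez gcdzMDl -/(coprimez _ _) coprimez_sym.
move=> n n0; have [m nm /eqz_modP e] := ua n n n0.
have [_ /eqz_modP ym] := aP m; have nf := dfact n m n0 nm.
have {}ym : (n%:Z %| y m`! - a m * x m`!)%Z by apply: dvdz_trans ym; rewrite dvdzE.
apply/eqz_modP; rewrite /zhat_mul.
have -> : y n - u n * x n = (y m`! - a m * x m`!) - (y m`! - y n)
  + (a m * (x m`! - x n) + x n * (a m - u n)) by ring.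
apply: rpredD; first by apply: rpredB => //; rewrite zhat_levelP ?fact_gt0.
by apply: rpredD; rewrite dvdz_mull // zhat_levelP ?fact_gt0.
Qed.

(** Take a cluster point of [A], where [A n] lies in [D] and is a multiple of all positive members
    of [D] up to n: for m >= n > 0, n divides [A m] exactly when n is in [D]. *)
Lemma zhat_of_divisors (D : nat -> Prop) : D 1%N ->
  (forall m n, (n %| m)%N -> D m -> D n) ->
  (forall m n, (0 < m)%N -> (0 < n)%N -> D m -> D n -> D (lcmn m n)) ->
  exists z, is_zhat z /\ forall n : nat, (0 < n)%N -> (n%:Z %| z n)%Z <-> D n.
Proof.
move=> D1 Ddvd Dlcm.
have /choice[A AP] (n : nat) : exists A : nat, [/\ (0 < A)%N, D A &
    forall k, (0 < k <= n)%N -> D k -> (k %| A)%N].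
  elim: n => [|n [A [A0 DA AP]]].
    by exists 1%N; split=> // k /andP[k0 /(leq_trans k0)].
  have [Dn|nDn] := pselect (D n.+1).
    exists (lcmn A n.+1); split; [by rewrite lcmn_gt0 A0 | exact: Dlcm |].
    move=> k /andP[k0]; rewrite leq_eqVlt => /orP[/eqP-> _|kn Dk].
      exact: dvdn_lcmr.
    by apply: dvdn_trans (dvdn_lcml _ _); apply: AP; rewrite // k0.
  exists A; split=> // k /andP[k0]; rewrite leq_eqVlt => /orP[/eqP->//|kn Dk].
  by apply: AP; rewrite // k0.
have [z [zz zA]] := zhat_cluster (fun n => (A n)%:Z).
exists z; split=> // n n0; have [m nm /eqz_modP zm] := zA n n n0.
have [A0 DA AP'] := AP m.
have -> : (n%:Z %| z n)%Z = (n %| A m)%N.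
  by rewrite -[RHS]/(n%:Z %| (A m)%:Z)%Z -[in RHS](subrK (z n) (A m)%:Z) rpredDl.
split=> [nA|Dn]; first exact: Ddvd DA.
by apply: AP' => //; rewrite n0.
Qed.

(** * Subgroups of the rationals *)

Lemma rat_frac2 (p q : rat) : exists (m n : int) (e : nat),
  [/\ (0 < e)%N, p = m%:~R / e%:R & q = n%:~R / e%:R].
Proof.
exists (numq p * denq q), (numq q * denq p), `|(denq p * denq q)%R|%N.
have dp : (denq p)%:~R != 0 :> rat by rewrite intr_eq0 denq_eq0.
have dq : (denq q)%:~R != 0 :> rat by rewrite intr_eq0 denq_eq0.
rewrite absz_gt0 mulf_neq0 ?denq_eq0 //.
rewrite pmulrn gtz0_abs ?mulr_gt0 ?denq_gt0 // !intrM.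
split=> //; first by rewrite -mulf_div divff // mulr1 divq_num_den.
by rewrite [X in _ / X]mulrC -mulf_div divff // mulr1 divq_num_den.
Qed.

Lemma rat_frac (p : rat) : exists (m : int) (e : nat), (0 < e)%N /\ p = m%:~R / e%:R.
Proof. by have [m [_ [e [e0 -> _]]]] := rat_frac2 p 0; exists m, e. Qed.

Section Subgroups.
Variables (V : zmodType) (S : V -> Prop).
Hypothesis sS : subgroup S.

Lemma subgroupN x : S x -> S (- x).
Proof. by case: sS => S0 SB Sx; rewrite -sub0r; apply: SB. Qed.

Lemma subgroupD x y : S x -> S y -> S (x + y).
Proof. by move=> Sx Sy; rewrite -[y]opprK; apply: sS.2 => //; apply: subgroupN. Qed.

Lemma subgroupMz x (n : int) : S x -> S (x *~ n).
Proof.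
move=> Sx; have Sn k : S (x *+ k).
  by elim: k => [|k IH]; [rewrite mulr0n; exact: sS.1 | rewrite mulrS; exact: subgroupD].
by case: n => n; [exact: Sn | apply: subgroupN; exact: Sn].
Qed.

Lemma additive_on0 (W : zmodType) (f : V -> W) : additive_on S f -> f 0 = 0.
Proof.
case: sS => S0 _ fD; apply: (addrI (f 0)).
by rewrite addr0 -fD // addr0.
Qed.

Lemma additive_onMz (W : zmodType) (f : V -> W) x (n : int) :
  additive_on S f -> S x -> f (x *~ n) = f x *~ n.
Proof.
move=> fD Sx; have fn k : f (x *+ k) = f x *+ k.
  elim: k => [|k IH]; first by rewrite !mulr0n additive_on0.
  by rewrite !mulrS fD ?IH //; exact: (subgroupMz _ k).
case: n => n; first exact: fn.
rewrite !NegzE !mulrNz -!pmulrn -fn; apply: (addIr (f (x *+ n.+1))).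
have Sn : S (x *+ n.+1) by exact: (subgroupMz _ n.+1).
by rewrite -fD ?addNr ?additive_on0 //; exact: subgroupN.
Qed.

Lemma torsion_free_mulIz x y (n : int) : torsion_free S -> S x -> S y ->
  n != 0 -> x *~ n = y *~ n -> x = y.
Proof.
move=> tS Sx Sy n0 /eqP; rewrite -subr_eq0 -mulrzBl => /eqP xy; apply/eqP.
rewrite -subr_eq0; apply/eqP; apply: (tS _ _ `|n|%N); rewrite ?absz_gt0 //.
  exact: sS.2.
by rewrite pmulrn abszEsg mulrC mulrzA xy mul0rz.
Qed.

End Subgroups.

Section RatSubgroups.
Variables S1 S2 : rat -> Prop.
Hypotheses (sS1 : subgroup S1) (sS2 : subgroup S2).

(** Over a common denominator e, Bezout makes gcd(m, n) / e an integral combination of x and y. *)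
Lemma rat_subgroup_generator2 (S : rat -> Prop) x y : subgroup S -> S x -> S y ->
  exists (t : rat) (m n : int), [/\ S t, x = t *~ m & y = t *~ n].
Proof.
move=> sS Sx Sy; have [m [n [e [e0 xE yE]]]] := rat_frac2 x y.
have [u [v uv]] := Bezoutz m n.
have /dvdzP[m1 mE] := dvdz_gcdl m n; have /dvdzP[n1 nE] := dvdz_gcdr m n.
have tE : x *~ u + y *~ v = (gcdz m n)%:~R / e%:R by rewrite -uv xE yE; ring.
exists (x *~ u + y *~ v), m1, n1; split.
- by apply: subgroupD => //; exact: subgroupMz.
- by rewrite tE xE {1}mE; ring.
- by rewrite tE yE {1}nE; ring.
Qed.

(** With x = m t and y = n t, both sides are m n t f(t). Dividing by a fixed nonzero element shows
    that f is multiplication by a constant. *)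
Lemma rat_additive_linear (f : rat -> rat) x y :
  additive_on S1 f -> S1 x -> S1 y -> f x * y = f y * x.
Proof.
move=> fD Sx Sy; have [t [m [n [St -> ->]]]] := rat_subgroup_generator2 _ _ _ sS1 Sx Sy.
rewrite !(additive_onMz _ _ sS1 _ _ _ _ fD) //.
by ring.
Qed.

(** With common generators t and s, [g] takes the value k l g(t, s) where the product is k l t s. If
    t s is nonzero, the product determines the integer k l. *)
Lemma biadditive_on_balanced (M : zmodType) (g : rat -> rat -> M) x y x' y' :
  biadditive_on S1 S2 g -> S1 x -> S2 y -> S1 x' -> S2 y' -> x * y = x' * y' ->
  g x y = g x' y'.
Proof.
move=> [gl gr] Sx Sy Sx' Sy'.
have [t [m [m' [St -> ->]]]] := rat_subgroup_generator2 _ _ _ sS1 Sx Sx'.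
have [s [n [n' [Ss -> ->]]]] := rat_subgroup_generator2 _ _ _ sS2 Sy Sy'.
have gMz k l : g (t *~ k) (s *~ l) = g t s *~ (k * l).
  have gD1 : additive_on S1 (g^~ (s *~ l)).
    by move=> u v Su Sv; apply: gl => //; exact: subgroupMz.
  have gD2 : additive_on S2 (g t) by move=> u v Su Sv; exact: gr.
  rewrite (additive_onMz _ _ sS1 _ (g^~ (s *~ l)) _ _ gD1) //.
  by rewrite (additive_onMz _ _ sS2 _ (g t) _ _ gD2) // -mulrzA mulrC.
have mE k l : t *~ k * (s *~ l) = (t * s) * (k * l)%:~R.
  by ring.
rewrite !gMz !mE; have [ts0|ts0] := eqVneq (t * s) 0; last first.
  by move=> /(mulfI ts0)/(intr_inj (R := rat))->.
(* If t or s is 0, additivity gives g(t, s) = 0 and both sides vanish. *)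
suff -> : g t s = 0 by rewrite !mul0rz.
move/eqP: ts0; rewrite mulf_eq0 => /orP[]/eqP E; rewrite E.
  by have := gMz 0 1; rewrite mul0r !mulr0z !mulr1z => <-; rewrite ?E.
by have := gMz 1 0; rewrite mulr0 !mulr0z !mulr1z => <-; rewrite ?E.
Qed.

Lemma rat_mul_is_tensor (S : rat -> Prop) :
  (forall x y, S1 x -> S2 y -> S (x * y)) ->
  (forall z, S z -> exists x y, [/\ S1 x, S2 y & z = x * y]) ->
  is_tensor S1 S2 S *%R.
Proof.
move=> Smul Ssplit; split=> //.
  by split=> [x x' y _ _ _|x y y' _ _ _]; rewrite (mulrDl, mulrDr).
move=> M g gb; split; last first.
  by move=> h1 h2 _ _ h12 z /Ssplit[x [y [Sx Sy ->]]]; exact: h12.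
(* Balancedness makes the value at x y independent of the factorization; 0 is a default off the
   products. *)
have /choice[h hP] (z : rat) : exists w : M,
    forall x y, S1 x -> S2 y -> x * y = z -> g x y = w.
  have [[x [y [Sx Sy xy]]]|N] := pselect (exists x y, [/\ S1 x, S2 y & x * y = z]).
    exists (g x y) => x' y' Sx' Sy' x'y'.
    by apply: biadditive_on_balanced => //; rewrite xy.
  by exists 0 => x y Sx Sy xy; case: N; exists x, y.
exists h; split; last by move=> x y Sx Sy; apply/esym/hP.
move=> _ _ /Ssplit[x [y [Sx Sy ->]]] /Ssplit[x' [y' [Sx' Sy' ->]]].
(* Both products are multiples of t s, where additivity of [h] becomes additivity of [g t]. *)
have [t [m [m' [St xE xE']]]] := rat_subgroup_generator2 _ _ _ sS1 Sx Sx'.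
have [s [n [n' [Ss yE yE']]]] := rat_subgroup_generator2 _ _ _ sS2 Sy Sy'.
have hE k : h (t * (s *~ k)) = g t (s *~ k).
  by rewrite -(hP (t * (s *~ k)) t (s *~ k)) //; exact: subgroupMz.
have mE k l : t *~ k * (s *~ l) = t * (s *~ (k * l)).
  by ring.
rewrite xE xE' yE yE' !mE -mulrDr -mulrzDr !hE mulrzDr.
by apply: gb.2 => //; exact: subgroupMz.
Qed.

End RatSubgroups.

(** * The lattice of an adele *)

(** [La] uses the reduced fraction, while this test accepts any representative. Cross-multiplying
    the two fractions relates the tests at the common level d L e. *)
Lemma La_fracP (R : realType) (a : adele R) (m : int) (e : nat) :
  is_adele a -> (0 < e)%N ->
  La a (m%:~R / e%:R) <->
  ((af_den a * e)%N%:Z %| m * af_num a (af_den a * e)%N)%Z.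
Proof.
case: a => z d r [/= zz d0] e0; rewrite /La /=.
set q := _ / _; set L := `|denq q|%N.
have L0 : (0 < L)%N by rewrite absz_gt0 denq_eq0.
have LE : L%:Z = denq q by rewrite gtz0_abs ?denq_gt0.
have mL : m * L%:Z = numq q * e%:Z.
  have /eqP : q = (numq q)%:~R / (denq q)%:~R by rewrite divq_num_den.
  rewrite eqr_div ?pnatr_eq0 -?lt0n // ?intr_eq0 ?denq_eq0 // => /eqP E.
  by apply: (intr_inj (R := rat)); rewrite LE !intrM.
set k := numq q in mL *.
have dL0 : (0 < d * L)%N by rewrite muln_gt0 d0.
have de0 : (0 < d * e)%N by rewrite muln_gt0 d0.
have dLe0 : (0 < d * L * e)%N by rewrite muln_gt0 dL0.
have -> : (exists w, is_zhat w /\ zhat_eq (zhat_scale (d * L)%N%:Z w) (zhat_scale k z)) <->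
  ((d * L)%N%:Z %| k * z (d * L)%N)%Z by apply/zhat_dvdP/is_zhat_scale.
rewrite -(zhat_dvd_level z k (d * L)%N (d * L * e)%N zz) //; last exact: dvdn_mulr.
have de_dvd : (d * e %| d * L * e)%N by rewrite mulnAC dvdn_mulr.
rewrite -(zhat_dvd_level z m (d * e)%N (d * L * e)%N zz) //.
have e0z : e%:Z != 0 by rewrite eqz_nat -lt0n.
have L0z : L%:Z != 0 by rewrite eqz_nat -lt0n.
rewrite -(dvdz_mul2r e0z) -(dvdz_mul2r (m := m * _) L0z).
by rewrite -PoszM -PoszM (mulnAC d e) mulrAC -mL mulrAC.
Qed.

Section Adeles.
Variable R : realType.
Implicit Types a b : adele R.

Lemma La_subgroup a : is_adele a -> subgroup (La a).
Proof.
move=> aa; split.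
  by have := La_fracP R a 0 1 aa isT; rewrite mul0r mul0r dvdz0 => ->.
move=> x y; have [m [n [e [e0 -> ->]]]] := rat_frac2 x y.
rewrite -mulrBl -intrB !La_fracP // mulrBl => *; exact: rpredB.
Qed.

Lemma La_adele_eq a b : is_adele a -> is_adele b -> adele_eq a b ->
  forall q, La a q -> La b q.
Proof.
case: a b => [za da ra] [zb db rb] aa ab [/= ab' _] q.
have [m [e [e0 ->]]] := rat_frac q.
rewrite !La_fracP //=; case: aa ab => /= [zza da0] [/= zzb db0].
have N0 : (0 < da * db * e)%N by rewrite !muln_gt0 da0 db0.
have ea : (da * e %| da * db * e)%N by rewrite mulnAC dvdn_mulr.
have eb : (db * e %| da * db * e)%N by rewrite -mulnA dvdn_mull.
rewrite -(zhat_dvd_level _ _ _ _ zza _ N0 ea) ?muln_gt0 ?da0 //.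
rewrite -(zhat_dvd_level _ _ _ _ zzb _ N0 eb) ?muln_gt0 ?db0 //.
have da0z : da%:Z != 0 by rewrite eqz_nat -lt0n.
have db0z : db%:Z != 0 by rewrite eqz_nat -lt0n.
rewrite -(dvdz_mul2l db0z) -(dvdz_mul2l (m := m * zb _) da0z) -!PoszM !mulnA.
have /eqz_modP := ab' _ N0; rewrite /zhat_scale (mulnC db) => D H.
rewrite mulrCA; have -> : da%:Z * zb (da * db * e)%N = db%:Z * za (da * db * e)%N -
  (db%:Z * za (da * db * e)%N - da%:Z * zb (da * db * e)%N) by ring.
by rewrite mulrBr rpredB ?(dvdz_mull _ D) // mulrCA.
Qed.

Lemma adele_eq_sym a b : adele_eq a b -> adele_eq b a.
Proof. by case=> ab e; split=> // n n0; rewrite ab. Qed.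

Lemma is_adele_act q u a : is_zhat u -> is_adele a -> is_adele (adele_act q u a).
Proof.
move=> zu [za da]; split; last by rewrite muln_gt0 da absz_gt0 denq_eq0.
exact/is_zhat_scale/is_zhat_mul.
Qed.

(** At level N the unit is prime to N, so it does not affect divisibility by N and only q
    remains. *)
Lemma La_act q u a : is_zhat_unit u -> is_adele a ->
  forall x, La (adele_act q u a) x <-> La a (q * x).
Proof.
move=> uu aa x; have [m [e [e0 ->]]] := rat_frac x.
have dq0 : (0 < `|denq q|)%N by rewrite absz_gt0 denq_eq0.
have -> : q * (m%:~R / e%:R) = (numq q * m)%:~R / (`|denq q| * e)%N%:R.
  rewrite natrM (pmulrn _ `|denq q|%N) gtz0_abs ?denq_gt0 // intrM -mulf_div.
  by rewrite divq_num_den.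
have [zu _] := uu; rewrite !La_fracP ?muln_gt0 ?dq0 //; last exact: is_adele_act.
rewrite /= /zhat_scale /zhat_mul -mulnA (mulnCA `|denq q|%N).
set N := (_ * (_ * _))%N.
have N0 : (0 < N)%N by case: aa => _ da0; rewrite !muln_gt0 dq0 da0.
have := zhat_unit_coprime _ _ uu N0; rewrite coprimez_sym => cu.
by rewrite !mulrA Gauss_dvdzl // (mulrC m).
Qed.

Lemma eq_La_unit a b : is_adele a -> is_adele b -> (forall q, La a q <-> La b q) ->
  exists u, is_zhat_unit u /\
    zhat_eq (zhat_scale (af_den a)%:Z (af_num b))
            (zhat_scale (af_den b)%:Z (zhat_mul u (af_num a))).
Proof.
case: a b => [za da ra] [zb db rb] aa ab ab_La.
case: (aa) (ab) => /= [zza da0] [/= zzb db0].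
have [|||u [uu ueq]] := same_divisors_unit (zhat_scale db%:Z za) (zhat_scale da%:Z zb).
- exact: is_zhat_scale.
- exact: is_zhat_scale.
(* Membership of da db / n in the two lattices means that n divides db za, respectively da zb. *)
- move=> n n0; have := ab_La ((da * db)%N%:~R / n%:R); rewrite !La_fracP //=.
  have da0z : da%:Z != 0 by rewrite eqz_nat -lt0n.
  have db0z : db%:Z != 0 by rewrite eqz_nat -lt0n.
  rewrite {2}(mulnC da) !PoszM -!mulrA (dvdz_mul2l da0z) (dvdz_mul2l db0z).
  rewrite (zhat_dvd_level _ _ n (da * n)%N) ?muln_gt0 ?da0 ?dvdn_mull //.
  rewrite (zhat_dvd_level _ _ n (db * n)%N) ?muln_gt0 ?db0 ?dvdn_mull //.
  by move=> H; apply/idP/idP; apply H.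
exists u; split=> // n n0; rewrite ueq // /zhat_mul /zhat_scale.
by rewrite mulrCA.
Qed.

End Adeles.

(** * The map Lambda on isomorphism classes *)

Section Divisors.
Variable R : realType.
Implicit Types a b : adele R.

Lemma La_den a : is_adele a -> La a (af_den a)%:R.
Proof.
move=> aa; have := La_fracP R a (af_den a) 1 aa isT; rewrite divr1 muln1 => ->.
exact: dvdz_mulr.
Qed.

Lemma La_arith_divisor a : is_adele a -> arith_divisor (La a) (Na a).
Proof.
move=> aa; split.
- exact: La_subgroup.
- move=> x _ n n0 /eqP; rewrite mulrn_eq0 => /orP[/eqP n00|/eqP//].
  by rewrite n00 in n0.
- split.
    exists (af_den a)%:R; split; first exact: La_den.
    by case: aa => _ d0; apply/eqP; rewrite pnatr_eq0 -lt0n.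
  move=> x y _ _; have [m [n [e [e0 -> ->]]]] := rat_frac2 x y.
  (* The coefficients n, m could both vanish when y = 0, hence the separate pair 0, 1. *)
  have [->|n0] := eqVneq n 0; last first.
    exists n, m; split; first by left; apply/eqP.
    by ring.
  by exists 0, 1; split; [right | rewrite mulr0z mul0r mul0rz].
- exists `|a_inf a|; split=> //; exists ratr; split; last split=> //.
    by move=> x y _ _; rewrite rmorphD.
  by move=> x _ /eqP; rewrite fmorph_eq0 => /eqP.
Qed.

(** The relation gives L_b = q^-1 L_a, so division by q is the isomorphism; the factor q in
    [a_inf b] restores the norm. *)
Lemma ad_iso_XQ_rel a b : is_adele a -> is_adele b -> XQ_rel a b ->
  ad_iso (La a) (Na a) (La b) (Na b).
Proof.
move=> aa ab [q [q0 [u [uu e]]]].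
have aact : is_adele (adele_act q u a) by apply: is_adele_act => //; case: uu.
have LE x : La b x <-> La a (q * x).
  rewrite -(La_act _ q u a uu aa); split; apply: La_adele_eq => //.
  exact: adele_eq_sym.
exists (fun x => x / q); split.
- by move=> x y _ _; rewrite mulrDl.
- by move=> x Lx; apply/LE; rewrite mulrC divfK.
- by move=> x y _ _ /(divIf q0).
- by move=> y /LE Ly; exists (q * y); rewrite // mulrC mulKf.
- move=> x _; rewrite /Na; case: e => _ /= ->; rewrite -!normrM.
  congr `|_|; rewrite fmorph_div; field.
  by rewrite fmorph_eq0.
Qed.

(** Acting by q alone already makes the lattices equal; the finite parts then differ by a unit. *)
Lemma XQ_rel_of_La a b (q : rat) : is_adele a -> is_adele b -> q != 0 ->
  (forall x, La b x <-> La a (q * x)) -> a_inf b = ratr q * a_inf a -> XQ_rel a b.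
Proof.
move=> aa ab q0 LE Ninf.
have u1 : is_zhat_unit (zhat_const 1) by apply: zhat_unitP => // n _; exact: coprime1n.
have aact := is_adele_act R q _ a u1.1 aa.
have LE' x : La (adele_act q (zhat_const 1) a) x <-> La b x by rewrite La_act // LE.
have [u [uu ueq]] := eq_La_unit R _ b aact ab LE'.
exists q; split=> //; exists u; split=> //; split=> // n n0.
have := ueq n n0; rewrite /= /zhat_scale /zhat_mul /zhat_const => ->.
by congr (_ %% _)%Z; ring.
Qed.

Lemma XQ_rel_ad_iso a b : is_adele a -> is_adele b ->
  ad_iso (La a) (Na a) (La b) (Na b) -> XQ_rel a b.
Proof.
move=> aa ab [psi [psiD psiL psi_inj psi_surj psiN]].
have sa := La_subgroup R a aa.
set x0 : rat := (af_den a)%:R; have Lx0 : La a x0 := La_den a aa.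
have x00 : x0 != 0 by case: aa => _ d0; rewrite pnatr_eq0 -lt0n.
(* [psi] is multiplication by c, so L_b = c L_a and c^-1 is the candidate for q. *)
pose c := psi x0 / x0.
have psiE x : La a x -> psi x = c * x.
  by move=> Lx; rewrite /c mulrAC -(rat_additive_linear _ sa _ _ _ psiD Lx Lx0) mulfK.
have c0 : c != 0.
  apply/eqP => c0; move/eqP: x00; apply; apply: psi_inj => //; first exact: sa.1.
  by rewrite !psiE ?c0 ?mul0r //; exact: sa.1.
have LE x : La b x <-> La a (c^-1 * x).
  split=> [/psi_surj[y Ly <-]|Lx]; first by rewrite psiE // mulKf.
  by have := psiL _ Lx; rewrite psiE // mulVKf.
have rx0 : ratr x0 != 0 :> R by rewrite fmorph_eq0.
have rc : ratr c != 0 :> R by rewrite fmorph_eq0.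
have : `|a_inf b| = `|ratr c^-1 * a_inf a|.
  have := psiN _ Lx0; rewrite psiE // /Na rmorphM /= -!normrM => E.
  apply: (mulIf (x := `|ratr c * ratr x0|)); first by rewrite normr_eq0 mulf_neq0.
  rewrite -!normrM E; congr `|_|; rewrite fmorphV; field.
  by rewrite fmorph_eq0.
(* The norms determine the real component only up to sign. As L_a = -L_a, the sign can be absorbed
   into q. *)
move/eqP; rewrite eqr_norm2 => /orP[]/eqP E.
  by apply: (XQ_rel_of_La _ _ c^-1); rewrite ?invr_eq0.
apply: (XQ_rel_of_La _ _ (- c^-1)); rewrite ?oppr_eq0 ?invr_eq0 //; last first.
  by rewrite E rmorphN mulNr.
by move=> x; rewrite LE mulNr; split=> /(subgroupN _ _ sa) //; rewrite opprK.
Qed.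

Lemma is_adele_mul a b : is_adele a -> is_adele b -> is_adele (adele_mul a b).
Proof.
by move=> [za da] [zb db]; split; [exact: is_zhat_mul | rewrite muln_gt0 da].
Qed.

Lemma La_mul a b x y : is_adele a -> is_adele b -> La a x -> La b y ->
  La (adele_mul a b) (x * y).
Proof.
move=> aa ab; have [m [e [e0 ->]]] := rat_frac x; have [n [f [f0 ->]]] := rat_frac y.
have aab := is_adele_mul _ _ aa ab.
rewrite mulf_div -intrM -natrM !La_fracP ?muln_gt0 ?e0 //=.
case: aa ab => za da [zb db]; rewrite mulnACA /zhat_mul.
set k := (af_den a * e)%N; set l := (af_den b * f)%N => ka lb.
have k0 : (0 < k)%N by rewrite muln_gt0 da.
have l0 : (0 < l)%N by rewrite muln_gt0 db.
have kl0 : (0 < k * l)%N by rewrite muln_gt0 k0.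
rewrite PoszM mulrACA; apply: dvdz_mul.
  by rewrite (zhat_dvd_level _ m k (k * l)%N) //; exact: dvdn_mulr.
by rewrite (zhat_dvd_level _ n l (k * l)%N) //; exact: dvdn_mull.
Qed.

(* Up to denominators z = m / e with e | m a b; then e = e1 e2 with
   e1 = gcd (e, m a), which divides m a, and e2 divides b. *)
Lemma La_mul_split a b z : is_adele a -> is_adele b -> La (adele_mul a b) z ->
  exists x y, [/\ La a x, La b y & z = x * y].
Proof.
move=> aa ab; have aab := is_adele_mul _ _ aa ab.
have [za da0] := aa; have [zb db0] := ab.
set da := af_den a in da0 *; set db := af_den b in db0 *.
have [m [e [e0 zE]]] := rat_frac (z / (da * db)%:R).
have dab0 : (da * db)%:R != 0 :> rat by rewrite pnatr_eq0 -lt0n muln_gt0 da0.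
have {}zE : z = ((da * db)%N%:Z * m)%:~R / e%:R.
  by rewrite intrM -mulrA -zE mulrC divfK.
rewrite zE La_fracP //= -/da -/db => H.
set N := (da * db * e)%N in H.
have N0 : (0 < N)%N by rewrite !muln_gt0 da0 db0.
have {}H : (e%:Z %| (m * af_num a N) * af_num b N)%Z.
  have dab0z : (da * db)%N%:Z != 0 by rewrite eqz_nat -lt0n muln_gt0 da0.
  by move: H; rewrite /N (PoszM (da * db)) -mulrA (dvdz_mul2l dab0z) mulrA.
have /dvdzP[e2 eE] := dvdz_gcdl e%:Z (m * af_num a N).
have e1a := dvdz_gcdr e%:Z (m * af_num a N).
set e1 := gcdn e `|(m * af_num a N)%R|%N.
have e1E : gcdz e%:Z (m * af_num a N) = e1%:Z by [].
rewrite e1E in eE e1a.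
have e10 : (0 < e1)%N by rewrite gcdn_gt0 e0.
have e10z : e1%:Z != 0 by rewrite eqz_nat -lt0n.
have [f fE] : exists f : nat, e2 = f%:Z.
  by exists `|e2|%N; rewrite gez0_abs // -(pmulr_lge0 _ (x := e1%:Z)) ?ltz_nat // -eE.
rewrite fE in eE; have f0 : (0 < f)%N.
  by rewrite lt0n; apply/eqP => f0; move: e0; rewrite -ltz_nat eE f0 mul0r ltxx.
have /dvdzP[k kE] := e1a.
have fb : (f%:Z %| af_num b N)%Z.
  have cfk : coprimez f%:Z k.
    have := mulz_gcdl f%:Z k e1%:Z; rewrite -kE -eE e1E -[RHS]mul1r.
    by move=> /(mulIf e10z)/eqP.
  have {H} : (f%:Z %| k * af_num b N)%Z by rewrite -(dvdz_mul2r e10z) -eE mulrAC -kE.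
  by rewrite Gauss_dvdzr.
have eN : e = (f * e1)%N by apply/eqP; rewrite -eqz_nat eE PoszM.
(* Each factor gets back the denominator of its own adele; m goes entirely to the first, since e1
   was extracted from m a. *)
exists ((da%:Z * m)%:~R / e1%:R), (db%:Z%:~R / f%:R).
have daz : da%:Z != 0 by rewrite eqz_nat -lt0n.
have dbz : db%:Z != 0 by rewrite eqz_nat -lt0n.
split.
- rewrite La_fracP // -/da PoszM -mulrA (dvdz_mul2l daz).
  rewrite (zhat_dvd_level _ m e1 (da * e1)%N) ?muln_gt0 ?da0 ?dvdn_mull //.
  by rewrite -(zhat_dvd_level _ m e1 N) // /N eN mulnA dvdn_mull.
- rewrite La_fracP // -/db PoszM (dvdz_mul2l dbz) -[af_num b _]mul1r.
  rewrite (zhat_dvd_level _ 1 f (db * f)%N) ?muln_gt0 ?db0 ?dvdn_mull //.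
  by rewrite -(zhat_dvd_level _ 1 f N) ?mul1r // /N eN mulnA dvdn_mulr // dvdn_mull.
- by rewrite mulf_div -natrM -intrM [(e1 * f)%N]mulnC -eN PoszM; congr (_%:~R / _); ring.
Qed.

Lemma Lambda_mul a b : is_adele a -> is_adele b ->
  is_product (La a) (Na a) (La b) (Na b) (La (adele_mul a b)) (Na (adele_mul a b)).
Proof.
move=> aa ab; exists *%R; split; last first.
  by move=> x y _ _; rewrite /Na /= rmorphM !normrM mulrACA.
apply: rat_mul_is_tensor; try exact: La_subgroup.
- by move=> x y; exact: La_mul.
- by move=> z; exact: La_mul_split.
Qed.

(* Fixing a nonzero x0 in S, the group S is isomorphic to the group of the
   rationals m / e such that m x0 is divisible by e in S, which is determined
   by the set of the e such that x0 itself is divisible by e. *)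
Lemma Lambda_surj (V : zmodType) (S : V -> Prop) (N : V -> R) : arith_divisor S N ->
  exists2 a : adele R, is_adele a & ad_iso (La a) (Na a) S N.
Proof.
move=> [sS tS [[x0 [Sx0 /eqP x00]] rk] [lam [lam0 [f [fD [f_inj fN]]]]]].
have cancel x y n := torsion_free_mulIz V S sS x y n tS.
have SM := subgroupMz V S sS.
pose D (e : nat) := exists2 x, S x & x *~ e = x0.
have [z [zz zD]] : exists z, is_zhat z /\
    forall n : nat, (0 < n)%N -> (n%:Z %| z n)%Z <-> D n.
  apply: zhat_of_divisors.
  - by exists x0.
  - move=> m n /dvdnP[k ->] [x Sx xE]; exists (x *~ k); first exact: SM.
    by rewrite -mulrzA -PoszM.
  - move=> m n m0 n0 [x Sx xE] [y Sy yE].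
    have [u [v uv]] := Bezoutz m n.
    have /dvdnP[m1 mE] := dvdn_gcdl m n; have /dvdnP[n1 nE] := dvdn_gcdr m n.
    have g0 : (0 < gcdn m n)%N by rewrite gcdn_gt0 m0.
    have lE : lcmn m n = (m1 * n)%N.
      by apply/eqP; rewrite -(eqn_pmul2r g0) muln_lcm_gcd mulnAC -mE.
    have lE' : lcmn m n = (n1 * m)%N.
      by apply/eqP; rewrite -(eqn_pmul2r g0) muln_lcm_gcd mulnAC -nE mulnC.
    (* With g = gcd(m, n) = u m + v n, multiplying this element by the lcm gives x0 (u m / g + v n /
       g) = x0. *)
    exists (y *~ u + x *~ v); first by apply: (subgroupD V S sS); exact: SM.
    have uv1 : u * m1%:Z + v * n1%:Z = 1.
      have g0z : (gcdn m n)%:Z != 0 by rewrite eqz_nat -lt0n.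
      apply: (mulIf g0z); rewrite mul1r -[RHS]uv {2}mE {3}nE !PoszM; ring.
    rewrite mulrzDl -!mulrzA; have -> : u * (lcmn m n)%:Z = n%:Z * (u * m1%:Z).
      by rewrite lE PoszM; ring.
    have -> : v * (lcmn m n)%:Z = m%:Z * (v * n1%:Z) by rewrite lE' PoszM; ring.
    by rewrite (mulrzA y) (mulrzA x) xE yE -mulrzDr uv1 mulr1z.
(* The rational 1 will correspond to x0, so r is the norm of x0. *)
pose r : R := lam * `|f x0|.
have az : is_adele (Adele z 1 r) by [].
(* This says x = q x0 with denominators cleared, since q does not act on [V]. *)
pose P (q : rat) (x : V) := S x /\ x *~ denq q = x0 *~ numq q.
have LE q : La (Adele z 1 r) q <-> exists x, P q x.
  have dE : `|denq q|%N%:Z = denq q by rewrite gtz0_abs ?denq_gt0.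
  have d0 : (0 < `|denq q|)%N by rewrite absz_gt0 denq_eq0.
  have cop : coprimez `|denq q|%N%:Z (numq q).
    by rewrite coprimez_sym; exact: coprime_num_den.
  have qE : q = (numq q)%:~R / `|denq q|%N%:R.
    by rewrite [_%:R]pmulrn dE divq_num_den.
  rewrite {1}qE (La_fracP _ _ _ _ az d0) /= mul1n Gauss_dvdzr // zD //.
  rewrite /D dE; split=> [[x Sx xE]|[x [Sx xE]]].
    by exists (x *~ numq q); split; [exact: SM | rewrite mulrzAC xE].
  (* From s denq + t numq = 1, the element s x0 + t x is a quotient of x0 by denq. *)
  have /coprimezP[[s t] /=] := cop; rewrite dE => st.
  exists (x0 *~ s + x *~ t); first by apply: (subgroupD V S sS); exact: SM.
  by rewrite mulrzDl (mulrzAC _ _ x) xE -!mulrzA -mulrzDr (mulrC (numq q)) st mulr1z.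
(* Torsion-freeness extends [P] to unreduced fractions, so that sums can be compared over a common
   denominator. *)
have PE q x (m n : int) : P q x -> m%:~R = q * n%:~R -> x *~ n = x0 *~ m.
  move=> [Sx xE] mn; apply: (cancel _ _ (denq q)); rewrite ?denq_eq0 //; try exact: SM.
  rewrite mulrzAC xE -!mulrzA; congr (_ *~ _).
  by apply: (intr_inj (R := rat)); rewrite !intrM mn numqE; ring.
have x0z k : x0 *~ k = 0 -> k = 0.
  move=> k0; apply/eqP/contraT => kN0; move/eqP: x00; case.
  by apply: (cancel _ _ k) => //; [exact: sS.1 | rewrite mul0rz].
have /choice[psi psiP] q : exists x, La (Adele z 1 r) q -> P q x.
  by have [/LE[x Px]|nL] := pselect (La (Adele z 1 r) q); [exists x | exists 0].
have sL := La_subgroup R _ az.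
exists (Adele z 1 r) => //; exists psi; split.
- move=> p q Lp Lq; have Lpq := subgroupD _ _ sL _ _ Lp Lq.
  have [Sp Sq Spq] := (And3 (psiP _ Lp).1 (psiP _ Lq).1 (psiP _ Lpq).1).
  apply: (cancel _ _ (denq p * denq q)) => //; first exact: (subgroupD V S sS).
    by rewrite mulf_neq0 ?denq_eq0.
  rewrite mulrzDl (PE _ _ (numq p * denq q) _ (psiP _ Lp)); last first.
    by rewrite !intrM numqE; ring.
  rewrite (PE _ _ (numq q * denq p) _ (psiP _ Lq)); last by rewrite !intrM numqE; ring.
  rewrite -mulrzDr; apply: (PE _ _ _ _ (psiP _ Lpq)).
  by rewrite intrD !intrM !numqE; ring.
- by move=> q Lq; case: (psiP _ Lq).
- move=> p q Lp Lq pq.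
  have Ep := PE _ _ (numq p * denq q) (denq p * denq q) (psiP _ Lp).
  have Eq := PE _ _ (numq q * denq p) (denq p * denq q) (psiP _ Lq).
  have /eqP : x0 *~ (numq p * denq q) - x0 *~ (numq q * denq p) = 0.
    by rewrite -Ep -?Eq ?pq ?subrr // !intrM numqE; ring.
  rewrite -mulrzBr => /eqP/x0z/eqP; rewrite subr_eq0 => /eqP E.
  have dp : (denq p)%:~R != 0 :> rat by rewrite intr_eq0 denq_eq0.
  have dq : (denq q)%:~R != 0 :> rat by rewrite intr_eq0 denq_eq0.
  apply: (mulIf dp); apply: (mulIf dq).
  by rewrite -numqE -intrM E intrM numqE mulrAC.
- move=> y Sy; have [m [n [mn ymn]]] := rk y x0 Sy Sx0.
  (* Otherwise n x0 = 0 forces n = 0 as well, against the nontriviality of the relation. *)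
  have m0 : m != 0.
    apply/eqP => m0; move: ymn; rewrite m0 mulr0z => /esym/x0z n0.
    by rewrite m0 n0 in mn; case: mn.
  have Pq : P (n%:~R / m%:~R) y.
    split=> //; apply: (cancel _ _ m) => //; try exact: SM.
    rewrite mulrzAC ymn -!mulrzA; congr (_ *~ _).
    apply: (intr_inj (R := rat)); rewrite !intrM numqE; field.
    by rewrite intr_eq0.
  have Lq : La (Adele z 1 r) (n%:~R / m%:~R) by apply/LE; exists y.
  exists (n%:~R / m%:~R) => //; case: (psiP _ Lq) Pq => Sx xE [_ yE].
  by apply: (cancel _ _ (denq (n%:~R / m%:~R))) => //; rewrite ?denq_eq0 // xE.
- move=> q Lq; have [Sx xE] := psiP _ Lq.
  rewrite fN // /Na /= /r normrM (ger0_norm lam0) normr_id -mulrA -normrM.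
  congr (_ * `|_|); have d0 : (denq q)%:~R != 0 :> R by rewrite intr_eq0 denq_eq0.
  apply: (mulIf d0); rewrite mulrzr -(additive_onMz _ _ sS _ _ _ _ fD) // xE.
  rewrite (additive_onMz _ _ sS _ _ _ _ fD) // -mulrzr /ratr.
  by field.
Qed.

End Divisors.

Theorem theorem3p4 (R : realType) :
  [/\ (* Lambda(a) is an arithmetic divisor *)
      (forall a : adele R, is_adele a -> arith_divisor (La a) (Na a)),
      (* Lambda is well defined on X_Q and injective on classes *)
      (forall a b : adele R, is_adele a -> is_adele b ->
         (XQ_rel a b <-> ad_iso (La a) (Na a) (La b) (Na b))),
      (* Lambda is multiplicative *)
      (forall a b : adele R, is_adele a -> is_adele b ->
         is_product (La a) (Na a) (La b) (Na b)
                    (La (adele_mul a b)) (Na (adele_mul a b))) &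
      (* Lambda is surjective onto Pic *)
      (forall (V : zmodType) (S : V -> Prop) (N : V -> R),
         arith_divisor S N ->
         exists2 a : adele R, is_adele a & ad_iso (La a) (Na a) S N)].
Proof.
split.
- exact: La_arith_divisor.
- by move=> a b aa ab; split; [exact: ad_iso_XQ_rel | exact: XQ_rel_ad_iso].
- exact: Lambda_mul.
- exact: Lambda_surj.
Qed.
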